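(* Let $f$ be an infinitely divisible probability density on $\mathbb{R}$ with finite second moment, i.e., let $$\hat f(t)=\exp\left(ibt+\int_{\mathbb{R}}\frac{\exp(ixt)-1-ixt}{x^2}\,M(dx)\right),\qquad t\in\mathbb{R},$$ where $b\in\mathbb{R}$ and $M$ is a finite positive measure on $\mathbb{R}$. Let $M(\{0\})=0$, let $b=0$, and let $g:\mathbb{R}\to\mathbb{R}$ be Lipschitz. Then $$K(g)(t):=\int_{\mathbb{R}}\frac{g(t+x)-g(t)}{x}\,M(dx),\qquad t\in\mathbb{R},$$ is a well defined real valued function, which is moreover bounded and continuous. Furthermore, for all $\theta\in\mathbb{R}$, $$\int_{\mathbb{R}}K(g)(x+\theta)f(x)\,dx=\int_{\mathbb{R}}x\,g(x+\theta)f(x)\,dx.$$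
   Context: Here $\hat f(t)=\int_{\mathbb{R}}e^{itx}f(x)\,dx$ denotes the Fourier transform (characteristic function) of the density $f$. *)

(* Defs.v *)
From HB Require Import structures.
From mathcomp Require Import all_boot all_order all_algebra.
From mathcomp Require Import complex.
From mathcomp Require Import all_classical all_reals all_analysis.
Set Implicit Arguments.
Unset Strict Implicit.
Unset Printing Implicit Defensive.
Import Order.TTheory GRing.Theory Num.Theory.
Import numFieldNormedType.Exports.
Local Open Scope classical_set_scope.
Local Open Scope ring_scope.
Local Open Scope complex_scope.

Definition cexp (R : realType) (z : R[i]) : R[i] :=
  (expR (complex.Re z) * cos (complex.Im z))
    +i* (expR (complex.Re z) * sin (complex.Im z)).

(* Both integrals below are meaningful wherever [cintegral] is used: the
   integrands are measurable and dominated by an integrable function. *)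
Definition cintegral (d : measure_display) (T : measurableType d)
    (R : realType) (mu : {measure set T -> \bar R}) (F : T -> R[i]) : R[i] :=
  (\int[mu]_x complex.Re (F x)) +i* (\int[mu]_x complex.Im (F x)).

Definition prob_density (R : realType) (f : R -> R) : Prop :=
  [/\ measurable_fun setT f, (forall x, 0 <= f x)
    & (\int[@lebesgue_measure R]_x (f x)%:E = 1)%E].

Definition fourier (R : realType) (f : R -> R) (t : R) : R[i] :=
  cintegral (@lebesgue_measure R) (fun x => cexp ('i * (t * x)%:C) * (f x)%:C).

(* (exp(ixt) - 1 - ixt) / x^2, extended by continuity at x = 0; this value
   matters only if M charges {0} (Gaussian component). *)
Definition kolmogorov_kernel (R : realType) (t x : R) : R[i] :=
  if x == 0 then (- (t ^+ 2 / 2))%:C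
  else (cexp ('i * (x * t)%:C) - 1 - 'i * (x * t)%:C) / (x ^+ 2)%:C.

(* Infinitely divisible density with finite second moment, through its
   Kolmogorov representation with characteristics b and M. *)
Definition infdiv_density2 (R : realType) (f : R -> R) (b : R)
    (M : {finite_measure set (measurableTypeR R) -> \bar R}) : Prop :=
  prob_density f /\
  forall t : R,
    fourier f t = cexp ('i * (b * t)%:C + cintegral M (kolmogorov_kernel t)).

(* At x = 0 the quotient is 0 since 0^-1 = 0; this is immaterial when
   M({0}) = 0. *)
Definition diff_quot (R : realType) (g : R -> R) (t x : R) : R :=
  (g (t + x) - g t) / x.

Definition K (R : realType)
    (M : {finite_measure set (measurableTypeR R) -> \bar R})
    (g : R -> R) (t : R) : R :=
  \int[M]_x diff_quot g t x.

(* Main.v *)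
Require Import Defs.
From HB Require Import structures.
From mathcomp Require Import all_boot all_order all_algebra.
From mathcomp Require Import complex.
From mathcomp Require Import all_classical all_reals all_analysis.
From mathcomp Require Import measurable_realfun ring lra.
Import Order.TTheory GRing.Theory Num.Theory.
Import numFieldNormedType.Exports.
Local Open Scope classical_set_scope.
Local Open Scope ring_scope.

Set Implicit Arguments.
Unset Strict Implicit.
Unset Printing Implicit Defensive.

(** The characteristic function of [f] is [phi = exp psi], where [psi] is the
    integral of the kernel against [M].

    Trigonometric functions. Since [psi t = O(t^2)], also [1 - Re phi t = O(t^2)],
    and Fatou's lemma shows that [f] has a finite second moment
    ([integrable_sqr_density]). Both [phi] and [psi] may then be differentiated
    under the integral sign, and [phi' = psi' phi] reads
      [int x e^(itx) f(x) dx
         = (int (e^(itx) - 1) / x M(dx)) (int e^(ity) f(y) dy)],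
    whose right-hand side is [int K(e_t) f] for [e_t y = e^(ity)]. Up to [theta],
    which is a translation of [g], this is the claim for sines and cosines
    ([stein_cos], [stein_sin]).

    Lipschitz functions. Both sides of the claim are linear in [g] and continuous
    along pointwise limits of functions with a common Lipschitz constant: the
    difference quotients are bounded by that constant, and [x * g x] is dominated
    by a quadratic function ([stein_limit]). It remains to approximate [g] in this
    sense by trigonometric polynomials. The function [g (N sin (x / N))] has the
    Lipschitz constant of [g] and tends to [g x]; it depends only on [g] on
    [-N, N], where [g] may be replaced by a Bernstein polynomial, which is
    uniformly close to [g] and has at most the same Lipschitz constant
    ([lip_le_trig_approx], [trig_approx_error]).

    Boundedness and continuity of [K g] are the bound and the dominated
    convergence theorem for the same difference quotients. *)

(** * Elementary bounds for sine and cosine *)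

Lemma mean_value_between (R : realType) (h dh : R -> R) (a b : R) :
  (forall x : R, is_derive x 1 h (dh x)) ->
  exists2 c, `|c - b| <= `|a - b| & h a - h b = dh c * (a - b).
Proof.
move=> hE.
have hc : continuous h.
  move=> x; apply: differentiable_continuous.
  by apply/derivable1_diffP; have [] := hE x.
have [ab|/ltW ba] := leP a b.
  have [c /itvP cab E] := MVT_segment ab (fun x _ => hE x)
    (continuous_subspaceT hc).
  exists c; last by rewrite -[LHS]opprB E; ring.
  by rewrite !ler0_norm ?subr_le0 ?cab // lerN2 lerD2r cab.
have [c /itvP cab E] := MVT_segment ba (fun x _ => hE x)
  (continuous_subspaceT hc).
exists c => //.
by rewrite !ger0_norm ?subr_ge0 ?cab // lerD2r cab.
Qed.

Lemma klipschitz_derive (R : realType) (h dh : R -> R) (k : R) :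
  (forall x : R, is_derive x 1 h (dh x)) -> (forall x, `|dh x| <= k) ->
  forall x y, `|h x - h y| <= k * `|x - y|.
Proof.
move=> hE dhk x y; have [c _ ->] := mean_value_between x y hE.
by rewrite normrM ler_wpM2r.
Qed.

Lemma norm_sin_le (R : realType) (y : R) : `|sin y| <= `|y|.
Proof.
have := klipschitz_derive (@is_derive_sin R) (@cos_max R) y 0.
by rewrite sin0 !subr0 mul1r.
Qed.

Lemma one_sub_cos (R : realType) (y : R) :
  1 - cos y = 2 * sin (y / 2) ^+ 2.
Proof.
have {1}-> : y = (y / 2) *+ 2 by rewrite mulr2n; field.
by rewrite cos_mulr2n cos2sin2 !mulr2n; ring.
Qed.

Lemma one_sub_cos_ge0 (R : realType) (y : R) : 0 <= 1 - cos y.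
Proof. by rewrite subr_ge0 cos_le1. Qed.

Lemma one_sub_cos_le (R : realType) (y : R) : 1 - cos y <= y ^+ 2 / 2.
Proof.
rewrite one_sub_cos.
have : sin (y / 2) ^+ 2 <= (y / 2) ^+ 2.
  by rewrite -[leLHS]real_normK ?num_real// -[leRHS]real_normK ?num_real//
    lerXn2r ?nnegrE// norm_sin_le.
by move=> h; lra.
Qed.

Lemma norm_cos_sub1_le (R : realType) (y : R) : `|cos y - 1| <= `|y|.
Proof.
have sin1 x : `|- sin x : R| <= 1 by rewrite normrN sin_max.
have := klipschitz_derive (@is_derive_cos R) sin1 y 0.
by rewrite cos0 subr0 mul1r.
Qed.

(** A quadratic bound suffices, although the left-hand side is cubic at 0: it is
    used both for the kernel of [phase] and for the rate of [n sin (x / n) --> x]. *)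
Lemma norm_sin_sub_le (R : realType) (y : R) : `|sin y - y| <= y ^+ 2.
Proof.
have dE (x : R) : is_derive x 1 (fun z : R => sin z - z) (cos x - 1).
  by apply: is_deriveB.
have [c cy /= E] := mean_value_between y 0 dE.
rewrite sin0 !subr0 in cy E; rewrite E normrM -real_normK ?num_real// expr2.
by rewrite ler_wpM2r// (le_trans (norm_cos_sub1_le c)).
Qed.

Lemma norm_scaled_sin_sub_le (R : realType) (n : nat) (x : R) :
  `|n.+1%:R * sin (x / n.+1%:R) - x| <= x ^+ 2 / n.+1%:R.
Proof.
have n0 : n.+1%:R != 0 :> R by rewrite pnatr_eq0.
have -> : n.+1%:R * sin (x / n.+1%:R) - x =
    n.+1%:R * (sin (x / n.+1%:R) - x / n.+1%:R).
  by rewrite mulrBr mulrCA mulfV // mulr1.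
have -> : x ^+ 2 / n.+1%:R = n.+1%:R * (x / n.+1%:R) ^+ 2 by field.
by rewrite normrM ger0_norm // ler_wpM2l // norm_sin_sub_le.
Qed.

(** * Dominated integrals *)

Lemma measurable_invr (R : realType) :
  measurable_fun setT (fun x : measurableTypeR R => x^-1 : R).
Proof.
have m0 : measurable [set (0 : measurableTypeR R)] by exact: measurable_set1.
have -> : [set: R] = [set 0] `|` ~` [set 0] by rewrite setUv.
apply: (measurable_funU _ m0 (measurableC m0)).2; split.
  exact: measurable_fun_set1.
apply: open_continuous_measurable_fun.
  exact: (closed_openC (@closed_eq R 0)).
by move=> x; rewrite inE => /eqP x0; apply: inv_continuous.
Qed.

(** The pointwise limits of the approximations below all come with a rate [O(1/n)]. *)
Lemma cvg_harmonic_bound (R : realType) (u : nat -> R) (l c : R) :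
  (forall n, `|u n - l| <= c / n.+1%:R) -> u n @[n --> \oo] --> l.
Proof.
move=> ul; apply/subr_cvg0/norm_cvg0P.
apply: (@squeeze_cvgr _ _ _ _ (fun=> 0) (fun n => c * harmonic n)).
- by apply: nearW => n; rewrite normr_ge0 ul.
- exact: cvg_cst.
- rewrite -[X in _ --> X](mulr0 c).
  by apply: cvgM; [exact: cvg_cst|exact: cvg_harmonic].
Qed.

Section dominated_integrals.
Context d (T : measurableType d) (R : realType).
Context (mu : {measure set T -> \bar R}).
Implicit Types h G : T -> R.

Lemma integrable_dominated h G : measurable_fun setT h ->
  mu.-integrable setT (EFin \o G) -> (forall x, `|h x| <= G x) ->
  mu.-integrable setT (EFin \o h).
Proof.
move=> mh iG hG; apply: le_integrable iG => //; first exact/measurable_EFinP.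
by move=> x _ /=; rewrite lee_fin (le_trans (hG x)) ?ler_norm.
Qed.

Lemma Rintegral_dominated_cvg (h_ : nat -> T -> R) h G :
  (forall n, measurable_fun setT (h_ n)) -> measurable_fun setT h ->
  (forall x, h_ n x @[n --> \oo] --> h x) ->
  mu.-integrable setT (EFin \o G) -> (forall n x, `|h_ n x| <= G x) ->
  \int[mu]_x h_ n x @[n --> \oo] --> \int[mu]_x h x.
Proof.
move=> mh_ mh cvh iG hG.
have mE_ n : measurable_fun setT (fun x => (h_ n x)%:E) by exact/measurable_EFinP.
have mE : measurable_fun setT (fun x => (h x)%:E) by exact/measurable_EFinP.
have cvE : {ae mu, forall x, setT x -> (h_ n x)%:E @[n --> \oo] --> (h x)%:E}.
  by apply: aeW => x _; apply: cvg_EFin; [exact: nearW|exact: cvh].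
have hGE : {ae mu, forall x n, setT x -> (`|(h_ n x)%:E| <= (G x)%:E)%E}.
  by apply: aeW => x n _; rewrite lee_fin.
have [ih _ cvI] := dominated_convergence measurableT mE_ mE cvE iG hGE.
by apply: fine_cvg; rewrite fineK; [exact: cvI|exact: (integrable_fin_num measurableT ih)].
Qed.

(** Differentiation under the integral sign; the domination is only asked near
    [a]: for the exponent of the characteristic function, the bound grows with [t]. *)
Lemma is_derive_Rintegral (F dF : R -> T -> R) G (a : R) :
  (forall t, mu.-integrable setT (EFin \o F t)) ->
  (forall (t : R) y, is_derive t 1 (F^~ y) (dF t y)) ->
  mu.-integrable setT (EFin \o G) ->
  (forall t y, t \in `]a - 1, a + 1[ -> `|dF t y| <= G y) ->
  is_derive a 1 (fun t => \int[mu]_y F t y) (\int[mu]_y dF a y).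
Proof.
move=> iF FE iG dFG.
have aI : `]a - 1, a + 1[%classic a by rewrite /= in_itv /=; lra.
have G0 y : 0 <= G y.
  by rewrite (le_trans _ (dFG a y _)) // in_itv /=; lra.
have derF x y : `]a - 1, a + 1[%classic x -> setT y -> derivable (F ^~ y) x 1.
  by have [] := FE x y.
have dE x y : partial1of2 F x y = dF x y.
  by rewrite partial1of2E; have [_ ->] := FE x y.
have dub x y : `]a - 1, a + 1[%classic x -> setT y ->
    `|partial1of2 F x y| <= G y.
  by move=> xI _; rewrite dE dFG.
have iF' x : `]a - 1, a + 1[%classic x -> mu.-integrable setT (EFin \o F x).
  by [].
split; first exact: (derivable_under_integral measurableT aI iF' derF G0 iG dub).
rewrite -derive1E.
rewrite (differentiation_under_integral measurableT aI iF' derF G0 iG dub).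
by apply: eq_Rintegral => y _; rewrite dE.
Qed.

End dominated_integrals.

(** Fatou's lemma as an integrability criterion. *)
Lemma integrable_fatou d (T : measurableType d) (R : realType)
    (mu : {measure set T -> \bar R}) (h_ : nat -> T -> R) (h : T -> R) (C : R) :
  (forall n, measurable_fun setT (h_ n)) -> measurable_fun setT h ->
  (forall n x, 0 <= h_ n x) -> (forall x, h_ n x @[n --> \oo] --> h x) ->
  (forall n, (\int[mu]_x (h_ n x)%:E <= C%:E)%E) ->
  mu.-integrable setT (EFin \o h).
Proof.
move=> mh_ mh h0 hh hC; apply/integrableP; split; first exact/measurable_EFinP.
have mE n : measurable_fun setT (fun x => (h_ n x)%:E) by exact/measurable_EFinP.
have h0E n x : setT x -> (0 <= (h_ n x)%:E)%E by rewrite lee_fin.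
have := fatou mu measurableT mE h0E.
have hE x : limn_einf (fun n => (h_ n x)%:E) = `|(h x)%:E|%E.
  have cvE : (h_ n x)%:E @[n --> \oo] --> (h x)%:E.
    by apply: cvg_EFin; [exact: nearW|exact: hh].
  rewrite (cvg_limn_einf_sup cvE).1 /= ger0_norm //.
  by rewrite -(cvg_lim _ (hh x)) //; apply: limr_ge; [exact: (cvgP _ (hh x))|exact: nearW].
under eq_integral do rewrite hE.
move=> /le_lt_trans; apply; apply: (@le_lt_trans _ _ C%:E); last exact: ltry.
rewrite limn_einf_lim; apply: lime_le; first exact: is_cvg_einfs.
by apply: nearW => n; rewrite (le_trans _ (hC n)) //; apply: ereal_inf_lbound; exists n => /=.
Qed.

Section finite_measure_bounds.
Context d (T : measurableType d) (R : realType).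
Context (mu : {finite_measure set T -> \bar R}).

Lemma integrable_bounded (h : T -> R) (c : R) :
  measurable_fun setT h -> (forall x, `|h x| <= c) ->
  mu.-integrable setT (EFin \o h).
Proof.
move=> mh hc; apply: (integrable_dominated mh _ hc).
exact: finite_measure_integrable_cst.
Qed.

Lemma norm_Rintegral_le (h : T -> R) (c : R) :
  measurable_fun setT h -> (forall x, `|h x| <= c) ->
  `|\int[mu]_x h x| <= c * fine (mu setT).
Proof.
move=> mh hc; have ih := integrable_bounded mh hc.
rewrite (le_trans (le_normr_Rintegral measurableT ih))//.
rewrite -(Rintegral_cst _ measurableT); apply: le_Rintegral => //.
  exact: integrable_norm.
exact: finite_measure_integrable_cst.
Qed.

End finite_measure_bounds.

(** The value at 0 of the kernel, which stands for a Gaussian component, may be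
    replaced by the one that [0^-1 = 0] gives to its formula off 0. *)
Lemma Rintegral_eq_off0 (R : realType)
    (mu : {measure set (measurableTypeR R) -> \bar R}) (h k : R -> R) :
  mu [set 0] = 0%E -> measurable_fun setT (h : measurableTypeR R -> R) ->
  (forall x, x != 0 -> k x = h x) -> \int[mu]_x k x = \int[mu]_x h x.
Proof.
move=> mu0 mh kh.
have m0 : measurable [set (0 : measurableTypeR R)] by exact: measurable_set1.
have kE : k = fun x => h x + (k 0 - h 0) * \1_[set 0] x.
  apply/funext => x; rewrite indicE.
  have [->|x0] := eqVneq x 0; first by rewrite mem_set// mulr1; ring.
  by rewrite memNset ?mulr0 ?addr0 ?kh //; exact/eqP.
have mk : measurable_fun setT (k : measurableTypeR R -> R).
  rewrite kE; apply: measurable_funD => //; apply: measurable_funM => //.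
congr fine; apply: ae_eq_integral => //; try exact/measurable_EFinP.
exists [set 0]; split => // x /= hx; apply/eqP; apply: contra_notT hx => x0 _.
by rewrite kh.
Qed.

(** * Real and imaginary parts of the characteristic function *)

Section complex_exponential.
Local Open Scope complex_scope.

Lemma cexp_i (R : realType) (y : R) : cexp ('i * y%:C) = cos y +i* sin y.
Proof. by rewrite /cexp; simpc => /=; rewrite expR0 !mul1r. Qed.

(** The characteristic function and its exponent are only ever handled through
    their real and imaginary parts. *)
Lemma fourierE (R : realType) (f : R -> R) (t : R) :
  fourier f t = (\int[lebesgue_measure]_x (cos (t * x) * f x))
    +i* (\int[lebesgue_measure]_x (sin (t * x) * f x)).
Proof.
rewrite /fourier /cintegral; congr (_ +i* _);
  by apply: eq_Rintegral => x _; rewrite cexp_i; simpc => /=.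
Qed.

Lemma kolmogorov_kernelE (R : realType) (t x : R) : x != 0 ->
  kolmogorov_kernel t x =
  ((cos (x * t) - 1) / x ^+ 2) +i* ((sin (x * t) - x * t) / x ^+ 2).
Proof.
move=> x0; rewrite /kolmogorov_kernel (negbTE x0) cexp_i -fmorphV.
by simpc.
Qed.

End complex_exponential.

(** * The exponent and its derivative *)

Lemma is_derive_cosM (R : realType) (x t : R) :
  is_derive t 1 (fun s => cos (x * s)) (- (x * sin (x * t))).
Proof.
have dx : is_derive t 1 ( *%R x) (x *: (1 : R)) by exact: is_deriveZ.
have -> : - (x * sin (x * t)) = (- sin (x * t)) * (x *: 1).
  by rewrite /GRing.scale /=; ring.
exact: is_derive1_comp.
Qed.

Lemma is_derive_sinM (R : realType) (x t : R) :
  is_derive t 1 (fun s => sin (x * s)) (x * cos (x * t)).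
Proof.
have dx : is_derive t 1 ( *%R x) (x *: (1 : R)) by exact: is_deriveZ.
have -> : x * cos (x * t) = cos (x * t) * (x *: 1).
  by rewrite /GRing.scale /=; ring.
exact: is_derive1_comp.
Qed.

Lemma norm_sin_quot_le (R : realType) (x t : R) : `|sin (x * t) / x| <= `|t|.
Proof.
have [->|x0] := eqVneq x 0; first by rewrite invr0 mulr0 normr0.
rewrite normrM normfV ler_pdivrMr ?normr_gt0//.
by rewrite (le_trans (norm_sin_le _))// normrM mulrC.
Qed.

Lemma norm_cos_quot_le (R : realType) (x t : R) :
  `|(cos (x * t) - 1) / x| <= `|t|.
Proof.
have [->|x0] := eqVneq x 0; first by rewrite invr0 mulr0 normr0.
rewrite normrM normfV ler_pdivrMr ?normr_gt0//.
by rewrite (le_trans (norm_cos_sub1_le _))// normrM mulrC.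
Qed.

Lemma norm_near_le (R : realType) (t s : R) :
  s \in `]t - 1, t + 1[ -> `|s| <= `|t| + 1.
Proof.
rewrite in_itv /= => /andP[s1 s2]; rewrite -lerBlDl.
by rewrite (le_trans (lerB_dist _ _))// ler_norml; lra.
Qed.

Section cumulant.
Context (R : realType) (M : {finite_measure set (measurableTypeR R) -> \bar R}).
Local Notation mass := (fine (M setT)).

(** Real part of the exponent [psi] of the characteristic function [exp psi],
    so that [exp log_modulus] is its modulus. *)
Definition log_modulus (t : R) : R := \int[M]_x ((cos (x * t) - 1) / x ^+ 2).

(** Imaginary part of [psi], a continuous choice of the argument. *)
Definition phase (t : R) : R := \int[M]_x ((sin (x * t) - x * t) / x ^+ 2).

Lemma measurable_cosM (t : R) :
  measurable_fun setT (fun x : measurableTypeR R => cos (x * t)).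
Proof.
apply: measurableT_comp; last exact: mulrr_measurable.
exact: (continuous_measurable_fun (@continuous_cos R)).
Qed.

Lemma measurable_sinM (t : R) :
  measurable_fun setT (fun x : measurableTypeR R => sin (x * t)).
Proof.
apply: measurableT_comp; last exact: mulrr_measurable.
exact: (continuous_measurable_fun (@continuous_sin R)).
Qed.

Lemma measurable_invr_sqr :
  measurable_fun setT (fun x : measurableTypeR R => (x ^+ 2)^-1).
Proof.
under eq_fun do rewrite -exprVn.
by apply: measurable_funX; exact: measurable_invr.
Qed.

Lemma measurable_cos_kernel (t : R) : measurable_fun setT
  (fun x : measurableTypeR R => (cos (x * t) - 1) / x ^+ 2).
Proof.
apply: measurable_funM; first by apply: measurable_funB => //; exact: measurable_cosM.
exact: measurable_invr_sqr.
Qed.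

Lemma measurable_sin_kernel (t : R) : measurable_fun setT
  (fun x : measurableTypeR R => (sin (x * t) - x * t) / x ^+ 2).
Proof.
apply: measurable_funM.
  by apply: measurable_funB; [exact: measurable_sinM|exact: mulrr_measurable].
exact: measurable_invr_sqr.
Qed.

Lemma norm_cos_kernel_le (t x : R) :
  `|(cos (x * t) - 1) / x ^+ 2| <= t ^+ 2 / 2.
Proof.
have [->|x0] := eqVneq x 0.
  by rewrite expr0n /= invr0 mulr0 normr0 divr_ge0 ?sqr_ge0.
have x2 : 0 < x ^+ 2 by rewrite exprn_even_gt0.
rewrite normrM normfV (gtr0_norm x2) ler_pdivrMr// -normrN opprB.
rewrite ger0_norm ?one_sub_cos_ge0// (le_trans (one_sub_cos_le _))//.
by rewrite exprMn; lra.
Qed.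

Lemma norm_sin_kernel_le (t x : R) :
  `|(sin (x * t) - x * t) / x ^+ 2| <= t ^+ 2.
Proof.
have [->|x0] := eqVneq x 0.
  by rewrite expr0n /= invr0 mulr0 normr0 sqr_ge0.
have x2 : 0 < x ^+ 2 by rewrite exprn_even_gt0.
rewrite normrM normfV (gtr0_norm x2) ler_pdivrMr//.
by rewrite (le_trans (norm_sin_sub_le _))// exprMn mulrC.
Qed.

Lemma log_modulus_le0 t : log_modulus t <= 0.
Proof.
have ik := integrable_bounded M (measurable_cos_kernel t) (norm_cos_kernel_le t).
rewrite -oppr_ge0 -[leRHS]mulN1r -(RintegralZl _ measurableT ik).
apply: Rintegral_ge0 => x _; rewrite mulN1r -mulNr opprB.
by rewrite divr_ge0 ?sqr_ge0 ?one_sub_cos_ge0.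
Qed.

Lemma norm_log_modulus_le t : `|log_modulus t| <= t ^+ 2 / 2 * mass.
Proof. exact: (norm_Rintegral_le M (measurable_cos_kernel t) (norm_cos_kernel_le t)). Qed.

Lemma norm_phase_le t : `|phase t| <= t ^+ 2 * mass.
Proof. exact: (norm_Rintegral_le M (measurable_sin_kernel t) (norm_sin_kernel_le t)). Qed.

Lemma measurable_sin_quot (t : R) : measurable_fun setT
  (fun x : measurableTypeR R => sin (x * t) / x).
Proof. by apply: measurable_funM; [exact: measurable_sinM|exact: measurable_invr]. Qed.

(** Differentiating the kernel cancels one factor [x] of [x ^+ 2]; what is left
    is the difference quotient of a sine or cosine, hence the operator [K]. *)
Lemma is_derive_log_modulus (t : R) :
  is_derive t 1 log_modulus (\int[M]_x (- (sin (x * t) / x))).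
Proof.
apply: (@is_derive_Rintegral _ _ _ M (fun s x => (cos (x * s) - 1) / x ^+ 2)
  (fun s x => - (sin (x * s) / x)) (fun=> `|t| + 1)).
- move=> s; exact: (integrable_bounded M (measurable_cos_kernel s) (norm_cos_kernel_le s)).
- move=> s x; have [->|x0] := eqVneq x 0.
    rewrite invr0 mulr0 oppr0 expr0n /= invr0; under eq_fun do rewrite mulr0.
    exact: is_derive_cst.
  have -> : - (sin (x * s) / x) = (x ^+ 2)^-1 *: (- (x * sin (x * s)) - 0).
    by rewrite /GRing.scale /=; field.
  under eq_fun do rewrite mulrC; apply: is_deriveZ; apply: is_deriveB.
  exact: is_derive_cosM.
- exact: finite_measure_integrable_cst.
- move=> s x st; rewrite normrN; apply: (le_trans (norm_sin_quot_le _ _)).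
  exact: norm_near_le.
Qed.

Lemma is_derive_phase (t : R) :
  is_derive t 1 phase (\int[M]_x ((cos (x * t) - 1) / x)).
Proof.
apply: (@is_derive_Rintegral _ _ _ M
  (fun s x => (sin (x * s) - x * s) / x ^+ 2)
  (fun s x => (cos (x * s) - 1) / x) (fun=> `|t| + 1)).
- move=> s; exact: (integrable_bounded M (measurable_sin_kernel s) (norm_sin_kernel_le s)).
- move=> s x; have [->|x0] := eqVneq x 0.
    rewrite invr0 mulr0 expr0n /= invr0; under eq_fun do rewrite mulr0.
    exact: is_derive_cst.
  have -> : (cos (x * s) - 1) / x = (x ^+ 2)^-1 *: (x * cos (x * s) - x *: 1).
    by rewrite /GRing.scale /=; field.
  under eq_fun do rewrite mulrC; apply: is_deriveZ; apply: is_deriveB.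
  exact: is_derive_sinM.
- exact: finite_measure_integrable_cst.
- move=> s x st; apply: (le_trans (norm_cos_quot_le _ _)).
  exact: norm_near_le.
Qed.

End cumulant.

(** * Moments of the density and the identity for sine and cosine *)

Section density.
Context (R : realType) (f : R -> R).
Context (M : {finite_measure set (measurableTypeR R) -> \bar R}).
Context (hf : infdiv_density2 f 0 M) (hM0 : M [set 0] = 0%E).
Local Notation lebesgue := (@lebesgue_measure R).
Local Notation mass := (fine (M setT)).

Lemma cintegral_kolmogorov_kernel (t : R) :
  cintegral M (kolmogorov_kernel t) = (log_modulus M t +i* phase M t)%C.
Proof.
rewrite /cintegral; congr (_ +i* _)%C.
  apply: (Rintegral_eq_off0 hM0 (measurable_cos_kernel t)) => x x0.
  by rewrite kolmogorov_kernelE.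
apply: (Rintegral_eq_off0 hM0 (measurable_sin_kernel t)) => x x0.
by rewrite kolmogorov_kernelE.
Qed.

Lemma charfun_polar (t : R) :
  \int[lebesgue]_x (cos (t * x) * f x) =
    expR (log_modulus M t) * cos (phase M t) /\
  \int[lebesgue]_x (sin (t * x) * f x) =
    expR (log_modulus M t) * sin (phase M t).
Proof.
have := hf.2 t; rewrite fourierE cintegral_kolmogorov_kernel /cexp mul0r.
by simpc => /= -[-> ->].
Qed.

Lemma measurable_density : measurable_fun setT f. Proof. by case: hf => -[]. Qed.

Lemma density_ge0 x : 0 <= f x. Proof. by case: hf => -[]. Qed.

Lemma integrable_density : lebesgue.-integrable setT (EFin \o f).
Proof.
case: hf => -[mf f0 f1] _; apply/integrableP; split; first exact/measurable_EFinP.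
under eq_integral do rewrite /= ger0_norm//.
by rewrite f1 ltry.
Qed.

Lemma Rintegral_density : \int[lebesgue]_x f x = 1.
Proof. by case: hf => -[_ _ f1] _; rewrite /Rintegral f1. Qed.

Lemma integrable_cos_density (t : R) :
  lebesgue.-integrable setT (EFin \o (fun x => cos (t * x) * f x)).
Proof.
apply: integrable_dominated integrable_density _; last first.
  by move=> x; rewrite normrM (ger0_norm (density_ge0 x)) ler_piMl ?cos_max// density_ge0.
apply: measurable_funM measurable_density.
by under eq_fun do rewrite mulrC; exact: measurable_cosM.
Qed.

Lemma integrable_sin_density (t : R) :
  lebesgue.-integrable setT (EFin \o (fun x => sin (t * x) * f x)).
Proof.
apply: integrable_dominated integrable_density _; last first.
  by move=> x; rewrite normrM (ger0_norm (density_ge0 x)) ler_piMl ?sin_max// density_ge0.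
apply: measurable_funM measurable_density.
by under eq_fun do rewrite mulrC; exact: measurable_sinM.
Qed.

(** The exponent is [O(t^2)], hence so is [1 - Re phi]; its imaginary part only
    contributes through its square. *)
Lemma one_sub_charfun_le (t : R) :
  1 - \int[lebesgue]_x (cos (t * x) * f x) <=
  t ^+ 2 / 2 * mass + (t ^+ 2 * mass) ^+ 2 / 2.
Proof.
rewrite (charfun_polar t).1.
have := norm_log_modulus_le M t; rewrite ler0_norm ?log_modulus_le0// => am.
have bm : phase M t ^+ 2 <= (t ^+ 2 * mass) ^+ 2.
  by rewrite -real_normK ?num_real// lerXn2r ?nnegrE ?norm_phase_le//
    (le_trans _ (norm_phase_le M t)).
have := expR_ge1Dx (log_modulus M t); have := one_sub_cos_le (phase M t).
have := one_sub_cos_ge0 (phase M t); have := expR_ge0 (log_modulus M t).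
have : expR (log_modulus M t) <= 1 by rewrite expR_le1 log_modulus_le0.
set e := expR _; set c := cos _ => e1 e0 c0 cb ea.
have : e * (1 - c) <= 1 - c by rewrite ler_piMl.
nra.
Qed.

(** The second moment is read off the characteristic function: the functions
    [(N sin (x / N))^2 = N^2 / 2 (1 - cos (2 x / N))] tend to [x^2] and, by
    [one_sub_charfun_le] at [t = 2 / N], their integrals are bounded. *)
Lemma integrable_sqr_density :
  lebesgue.-integrable setT (EFin \o (fun x => x ^+ 2 * f x)).
Proof.
pose N n : R := n.+1%:R.
have N0 n : N n != 0 by rewrite pnatr_eq0.
apply: (@integrable_fatou _ _ _ lebesgue
  (fun n x => (N n * sin (x / N n)) ^+ 2 * f x) _ (mass + 4 * mass ^+ 2)).
- move=> n; apply: measurable_funM measurable_density.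
  apply: measurable_funX; apply: measurable_funM => //.
  exact: measurable_sinM.
- by apply: measurable_funM measurable_density; exact: exprn_measurable.
- by move=> n x; rewrite mulr_ge0 ?sqr_ge0 ?density_ge0.
- move=> x; apply: cvgM; last exact: cvg_cst.
  have cx : N n * sin (x / N n) @[n --> \oo] --> x.
    by apply: cvg_harmonic_bound => n; exact: norm_scaled_sin_sub_le.
  by apply: (cvgM cx cx).
move=> n.
have iE x : (N n * sin (x / N n)) ^+ 2 * f x =
    N n ^+ 2 / 2 * (f x - cos (2 / N n * x) * f x).
  have -> : (f x - cos (2 / N n * x) * f x) =
    (1 - cos (2 / N n * x)) * f x by ring.
  rewrite one_sub_cos (_ : 2 / N n * x / 2 = x / N n); last by field.
  by field.
have ic := integrable_cos_density (2 / N n).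
have ii := integrableB measurableT integrable_density ic.
have iz := integrableZl measurableT (N n ^+ 2 / 2) ii.
under eq_integral do rewrite iE.
rewrite -[leLHS]fineK ?(integrable_fin_num measurableT iz)// lee_fin.
rewrite -/(Rintegral _ _ _) RintegralZl// RintegralB//; last exact: integrable_density.
rewrite Rintegral_density.
have := one_sub_charfun_le (2 / N n); set u := 1 - _ => ule.
have N2 : 0 < N n ^+ 2 / 2 by rewrite divr_gt0 ?exprn_gt0.
rewrite (le_trans (ler_wpM2l (ltW N2) ule))//.
have -> : N n ^+ 2 / 2 * ((2 / N n) ^+ 2 / 2 * mass +
    ((2 / N n) ^+ 2 * mass) ^+ 2 / 2) = mass + 4 * mass ^+ 2 * (N n)^-1 ^+ 2.
  by field.
rewrite lerD2l; apply: ler_piMr; first by rewrite mulr_ge0 ?sqr_ge0.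
by apply: exprn_ile1; rewrite ?invr_ge0// invf_le1// ler1n.
Qed.

Lemma integrable_quadratic_density (a b c : R) :
  lebesgue.-integrable setT (EFin \o (fun x => (a + b * `|x| + c * x ^+ 2) * f x)).
Proof.
have i02 : lebesgue.-integrable setT (EFin \o
    (fun x => (`|a| + `|b| + (`|b| + `|c|) * x ^+ 2) * f x)).
  apply: eq_integrable (integrableD measurableT
    (integrableZl measurableT (`|a| + `|b|) integrable_density)
    (integrableZl measurableT (`|b| + `|c|) integrable_sqr_density)) => // x _ /=.
  by rewrite -!EFinM -EFinD; congr EFin; ring.
apply: (integrable_dominated _ i02).
  apply: measurable_funM measurable_density; apply: measurable_funD.
    by apply: measurable_funD => //; apply: measurable_funM => //; exact: normr_measurable.
  by apply: measurable_funM => //; exact: exprn_measurable.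
move=> x /=; rewrite normrM (ger0_norm (density_ge0 x)).
rewrite ler_wpM2r ?density_ge0//.
have x1 : `|x| <= 1 + x ^+ 2.
  by rewrite -[x ^+ 2]real_normK ?num_real//; have := normr_ge0 x; nra.
move: (x ^+ 2) (sqr_ge0 x) x1 => y y0 x1.
rewrite (le_trans (ler_normD _ _))// (le_trans (lerD (ler_normD _ _) (lexx _)))//.
rewrite !normrM normr_id (ger0_norm y0).
by have := ler_wpM2l (normr_ge0 b) x1; lra.
Qed.

Lemma integrable_abs_density :
  lebesgue.-integrable setT (EFin \o (fun x => `|x| * f x)).
Proof.
apply: eq_integrable (integrable_quadratic_density 0 1 0) => // x _ /=.
by rewrite mul0r add0r addr0 mul1r.
Qed.

Lemma is_derive_cos_density (t : R) :
  is_derive t 1 (fun t => \int[lebesgue]_x (cos (t * x) * f x))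
    (- \int[lebesgue]_x (x * sin (t * x) * f x)).
Proof.
rewrite -mulN1r -RintegralZl//; last first.
  apply: (integrable_dominated _ integrable_abs_density).
    apply: measurable_funM measurable_density; apply: measurable_funM => //.
    by under eq_fun do rewrite mulrC; exact: measurable_sinM.
  move=> x; rewrite !normrM (ger0_norm (density_ge0 x)) ler_wpM2r ?density_ge0//.
  by rewrite ler_piMr ?sin_max.
apply: (@is_derive_Rintegral _ _ _ lebesgue (fun t x => cos (t * x) * f x)
  (fun t x => -1 * (x * sin (t * x) * f x)) (fun x => `|x| * f x)).
- exact: integrable_cos_density.
- move=> s x.
  have -> : -1 * (x * sin (s * x) * f x) = f x *: - (x * sin (x * s)).
    by rewrite /GRing.scale /= (mulrC x s); ring.
  rewrite [X in is_derive _ _ X _](_ : _ = f x *: (fun s => cos (x * s))).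
    by apply: is_deriveZ; exact: is_derive_cosM.
  by apply/funext => r; rewrite /GRing.scale /= mulrC (mulrC r).
- exact: integrable_abs_density.
- move=> s x _; rewrite !normrM normrN1 mul1r (ger0_norm (density_ge0 x)).
  by rewrite ler_wpM2r ?density_ge0// ler_piMr ?sin_max.
Qed.

Lemma is_derive_sin_density (t : R) :
  is_derive t 1 (fun t => \int[lebesgue]_x (sin (t * x) * f x))
    (\int[lebesgue]_x (x * cos (t * x) * f x)).
Proof.
apply: (@is_derive_Rintegral _ _ _ lebesgue (fun t x => sin (t * x) * f x)
  (fun t x => x * cos (t * x) * f x) (fun x => `|x| * f x)).
- exact: integrable_sin_density.
- move=> s x.
  have -> : x * cos (s * x) * f x = f x *: (x * cos (x * s)).
    by rewrite /GRing.scale /= (mulrC x s); ring.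
  rewrite [X in is_derive _ _ X _](_ : _ = f x *: (fun s => sin (x * s))).
    by apply: is_deriveZ; exact: is_derive_sinM.
  by apply/funext => r; rewrite /GRing.scale /= mulrC (mulrC r).
- exact: integrable_abs_density.
- move=> s x _; rewrite !normrM (ger0_norm (density_ge0 x)).
  by rewrite ler_wpM2r ?density_ge0// ler_piMr ?cos_max.
Qed.

Local Notation dlog_modulus t := (\int[M]_x (- (sin (x * t) / x))).
Local Notation dphase t := (\int[M]_x ((cos (x * t) - 1) / x)).

(** Imaginary part of [phi' = psi' phi], differentiating [phi] on the one side
    under the integral sign and on the other side in polar form. *)
Lemma Rintegral_id_cos_density (t : R) :
  \int[lebesgue]_x (x * cos (t * x) * f x) =
    dphase t * \int[lebesgue]_x (cos (t * x) * f x) +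
    dlog_modulus t * \int[lebesgue]_x (sin (t * x) * f x).
Proof.
have dv := is_derive_sin_density t.
have da := is_derive_log_modulus M t; have db := is_derive_phase M t.
have vE : (fun t => \int[lebesgue]_x (sin (t * x) * f x)) =
    (expR \o log_modulus M) * (sin \o phase M).
  by apply/funext => s; rewrite (charfun_polar s).2.
rewrite -(@derive_val _ _ _ _ _ _ _ dv) vE derive_val /GRing.scale /=.
by rewrite (charfun_polar t).1 (charfun_polar t).2; ring.
Qed.

(** Real part of [phi' = psi' phi]. *)
Lemma Rintegral_id_sin_density (t : R) :
  \int[lebesgue]_x (x * sin (t * x) * f x) =
    dphase t * \int[lebesgue]_x (sin (t * x) * f x) -
    dlog_modulus t * \int[lebesgue]_x (cos (t * x) * f x).
Proof.
have du := is_derive_cos_density t.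
have da := is_derive_log_modulus M t; have db := is_derive_phase M t.
have uE : (fun t => \int[lebesgue]_x (cos (t * x) * f x)) =
    (expR \o log_modulus M) * (cos \o phase M).
  by apply/funext => s; rewrite (charfun_polar s).1.
apply: oppr_inj.
rewrite -(@derive_val _ _ _ _ _ _ _ du) uE derive_val /GRing.scale /=.
by rewrite (charfun_polar t).1 (charfun_polar t).2; ring.
Qed.

Lemma integrable_sin_quot (t : R) :
  M.-integrable setT (EFin \o (fun x => - (sin (x * t) / x))).
Proof.
apply: (@integrable_bounded _ _ _ M _ `|t|) => [|x].
  by apply: measurable_funN; exact: measurable_sin_quot.
by rewrite normrN norm_sin_quot_le.
Qed.

Lemma integrable_cos_quot (t : R) :
  M.-integrable setT (EFin \o (fun x => (cos (x * t) - 1) / x)).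
Proof.
apply: (@integrable_bounded _ _ _ M _ `|t|) => [|x]; last exact: norm_cos_quot_le.
apply: measurable_funM; last exact: measurable_invr.
by apply: measurable_funB => //; exact: measurable_cosM.
Qed.

(** By the addition formulas, [K] acts on the span of [cos (t * _)] and
    [sin (t * _)] as multiplication of [exp (i t y)] by [psi' t / i]. *)
Lemma K_cos (t y : R) : K M (fun x => cos (t * x)) y =
  cos (t * y) * dphase t + sin (t * y) * dlog_modulus t.
Proof.
have ic := integrable_cos_quot t; have isn := integrable_sin_quot t.
rewrite -!RintegralZl// -RintegralD//; last 2 first.
  exact: (integrableZl measurableT (cos (t * y)) ic).
  exact: (integrableZl measurableT (sin (t * y)) isn).
apply: eq_Rintegral => x _; rewrite /diff_quot mulrDr cosD (mulrC x t); ring.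
Qed.

Lemma K_sin (t y : R) : K M (fun x => sin (t * x)) y =
  sin (t * y) * dphase t - cos (t * y) * dlog_modulus t.
Proof.
have ic := integrable_cos_quot t; have isn := integrable_sin_quot t.
rewrite -!RintegralZl// -RintegralB//; last 2 first.
  exact: (integrableZl measurableT (sin (t * y)) ic).
  exact: (integrableZl measurableT (cos (t * y)) isn).
apply: eq_Rintegral => x _; rewrite /diff_quot mulrDr sinD (mulrC x t); ring.
Qed.

(** The identity to be proved, at [theta = 0]; the general case follows by
    translating [g]. *)
Definition stein_identity (g : R -> R) : Prop :=
  \int[lebesgue]_x (K M g x * f x) = \int[lebesgue]_x (x * g x * f x).

Lemma stein_cos (t : R) : stein_identity (fun x => cos (t * x)).
Proof.
have ic := integrable_cos_density t; have isn := integrable_sin_density t.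
rewrite /stein_identity Rintegral_id_cos_density -!RintegralZl// -RintegralD//; last 2 first.
  exact: (integrableZl measurableT _ ic).
  exact: (integrableZl measurableT _ isn).
by apply: eq_Rintegral => x _; rewrite K_cos; ring.
Qed.

Lemma stein_sin (t : R) : stein_identity (fun x => sin (t * x)).
Proof.
have ic := integrable_cos_density t; have isn := integrable_sin_density t.
rewrite /stein_identity Rintegral_id_sin_density -!RintegralZl// -RintegralB//; last 2 first.
  exact: (integrableZl measurableT _ isn).
  exact: (integrableZl measurableT _ ic).
by apply: eq_Rintegral => x _; rewrite K_sin; ring.
Qed.

End density.

(** * Lipschitz functions under the operator K *)

Section lipschitz_functions.
Context (R : realType).
Implicit Types (g h : R -> R) (L : R).

(** The constant is explicit because the convergence arguments need one that is
    shared by a whole sequence of functions. *)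
Definition lip_le L g := forall x y, `|g x - g y| <= L * `|x - y|.

Lemma lipschitz_lip_le g : lipschitz g -> exists L, lip_le L g.
Proof.
move=> [L [_ gL]]; exists (L + 1) => x y.
have /= := gL (L + 1); rewrite ltrDl ltr01 => /(_ isT) /(_ (x, y)) /=.
by apply.
Qed.

Lemma lip_le_ge0 L g : lip_le L g -> 0 <= L.
Proof.
by move=> /(_ 1 0); rewrite subr0 normr1 mulr1; apply: le_trans.
Qed.

Lemma lip_leD L1 L2 g h :
  lip_le L1 g -> lip_le L2 h -> lip_le (L1 + L2) (fun x => g x + h x).
Proof.
move=> gL hL x y; rewrite opprD addrACA (le_trans (ler_normD _ _))//.
by rewrite mulrDl lerD.
Qed.

Lemma lip_leZ L c g : lip_le L g -> lip_le (`|c| * L) (fun x => c * g x).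
Proof. by move=> gL x y; rewrite -mulrBr normrM -mulrA ler_wpM2l. Qed.

Lemma lip_le_shift L g c : lip_le L g -> lip_le L (fun x => g (x + c)).
Proof. by move=> gL x y; rewrite (le_trans (gL _ _))// opprD addrACA subrr addr0. Qed.

Lemma lip_le_growth L g x : lip_le L g -> `|g x| <= `|g 0| + L * `|x|.
Proof.
move=> gL; have := gL x 0; rewrite subr0 => gx.
by rewrite -(subrK (g 0) (g x)) addrC (le_trans (ler_normD _ _))// lerD2l.
Qed.

Lemma lip_le_continuous L g : lip_le L g -> continuous g.
Proof.
move=> gL x; apply/cvgrPdist_le => e e0.
have L1 : 0 < L + 1 by rewrite ltr_wpDl// (lip_le_ge0 gL).
near=> y; rewrite (le_trans (gL _ _))//.
rewrite (@le_trans _ _ ((L + 1) * `|x - y|))//; first by rewrite ler_wpM2r// lerDl.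
rewrite mulrC -ler_pdivlMr//; near: y.
by apply: cvgr_dist_le => //; rewrite divr_gt0.
Unshelve. all: by end_near. Qed.

Lemma lip_le_cos t : lip_le `|t| (fun x => cos (t * x)).
Proof.
apply: (klipschitz_derive (is_derive_cosM t)) => x.
by rewrite normrN normrM ler_piMr// sin_max.
Qed.

Lemma lip_le_sin t : lip_le `|t| (fun x => sin (t * x)).
Proof.
apply: (klipschitz_derive (is_derive_sinM t)) => x.
by rewrite normrM ler_piMr// cos_max.
Qed.

Context (M : {finite_measure set (measurableTypeR R) -> \bar R}).
Local Notation mass := (fine (M setT)).

Lemma norm_diff_quot_le L g t x : lip_le L g -> `|diff_quot g t x| <= L.
Proof.
move=> gL; rewrite /diff_quot; have [->|x0] := eqVneq x 0.
  by rewrite invr0 mulr0 normr0 (lip_le_ge0 gL).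
rewrite normrM normfV ler_pdivrMr ?normr_gt0// (le_trans (gL _ _))//.
by rewrite addrC addKr.
Qed.

Lemma measurable_lip_le L g : lip_le L g ->
  measurable_fun setT (g : measurableTypeR R -> R).
Proof. by move=> gL; exact: (continuous_measurable_fun (lip_le_continuous gL)). Qed.

Lemma measurable_diff_quot L g t : lip_le L g ->
  measurable_fun setT (diff_quot g t : measurableTypeR R -> R).
Proof.
move=> gL; apply: measurable_funM; last exact: measurable_invr.
apply: measurable_funB => //; under eq_fun do rewrite addrC.
exact: measurable_lip_le (lip_le_shift t gL).
Qed.

Lemma integrable_diff_quot L g t : lip_le L g ->
  M.-integrable setT (EFin \o diff_quot g t).
Proof.
move=> gL; apply: (integrable_bounded M (measurable_diff_quot t gL)) => x.
exact: norm_diff_quot_le.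
Qed.

Lemma norm_K_le L g t : lip_le L g -> `|K M g t| <= L * mass.
Proof.
move=> gL; apply: (norm_Rintegral_le M (measurable_diff_quot t gL)) => x.
exact: norm_diff_quot_le.
Qed.

Lemma K_continuous L g : lip_le L g -> continuous (K M g).
Proof.
move=> gL a; apply/(@cvg_nbhsP _ R^o) => w wa.
apply: (@Rintegral_dominated_cvg _ _ _ M (fun n => diff_quot g (w n)) _ (fun=> L)).
- by move=> n; exact: measurable_diff_quot gL.
- exact: measurable_diff_quot gL.
- move=> x; apply: cvgM; last exact: cvg_cst.
  have gc := lip_le_continuous gL.
  apply: cvgB; last by apply: continuous_cvg; [exact: gc|exact: wa].
  apply: continuous_cvg; first exact: gc.
  by apply: cvgD; [exact: wa|exact: cvg_cst].
- exact: finite_measure_integrable_cst.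
- by move=> n x; exact: norm_diff_quot_le.
Qed.

(** A common Lipschitz constant bounds all the difference quotients, so that
    pointwise convergence of the functions is enough. *)
Lemma K_cvg L (g_ : nat -> R -> R) g t :
  (forall n, lip_le L (g_ n)) -> lip_le L g ->
  (forall x, g_ n x @[n --> \oo] --> g x) ->
  K M (g_ n) t @[n --> \oo] --> K M g t.
Proof.
move=> gL_ gL gg.
apply: (@Rintegral_dominated_cvg _ _ _ M (fun n => diff_quot (g_ n) t) _ (fun=> L)).
- by move=> n; exact: measurable_diff_quot (gL_ n).
- exact: measurable_diff_quot gL.
- by move=> x; apply: cvgM; [exact: cvgB|exact: cvg_cst].
- exact: finite_measure_integrable_cst.
- by move=> n x; exact: norm_diff_quot_le.
Qed.

Lemma K_add L1 L2 g h t : lip_le L1 g -> lip_le L2 h ->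
  K M (fun x => g x + h x) t = K M g t + K M h t.
Proof.
move=> gL hL.
rewrite /K -(RintegralD measurableT (integrable_diff_quot t gL)
  (integrable_diff_quot t hL)).
by apply: eq_Rintegral => x _; rewrite /diff_quot; ring.
Qed.

Lemma K_scale L g c t : lip_le L g -> K M (fun x => c * g x) t = c * K M g t.
Proof.
move=> gL; rewrite /K -(RintegralZl _ measurableT (integrable_diff_quot t gL)).
by apply: eq_Rintegral => x _; rewrite /diff_quot; ring.
Qed.

Lemma K_shift g c t : K M (fun x => g (x + c)) t = K M g (t + c).
Proof. by apply: eq_Rintegral => x _; rewrite /diff_quot addrAC. Qed.

End lipschitz_functions.

(** * Linearity and continuity of the identity *)

Section stein_class.
Context (R : realType) (f : R -> R).
Context (M : {finite_measure set (measurableTypeR R) -> \bar R}).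
Context (hf : infdiv_density2 f 0 M) (hM0 : M [set 0] = 0%E).
Local Notation lebesgue := (@lebesgue_measure R).
Local Notation mass := (fine (M setT)).

Lemma measurable_K_density L g : lip_le L g ->
  measurable_fun setT (fun x : measurableTypeR R => K M g x * f x).
Proof.
move=> gL; apply: measurable_funM (measurable_density hf).
exact: (continuous_measurable_fun (K_continuous gL)).
Qed.

Lemma measurable_id_density L g : lip_le L g ->
  measurable_fun setT (fun x : measurableTypeR R => x * g x * f x).
Proof.
move=> gL; apply: measurable_funM (measurable_density hf).
by apply: measurable_funM => //; exact: measurable_lip_le gL.
Qed.

Lemma norm_K_density_le L g x : lip_le L g ->
  `|K M g x * f x| <= (L * mass + 0 * `|x| + 0 * x ^+ 2) * f x.
Proof.
move=> gL; rewrite normrM (ger0_norm (density_ge0 hf x)) ler_wpM2r ?(density_ge0 hf)//.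
by rewrite !mul0r !addr0 norm_K_le.
Qed.

Lemma norm_id_density_le L A g x : lip_le L g -> `|g 0| <= A ->
  `|x * g x * f x| <= (0 + A * `|x| + L * x ^+ 2) * f x.
Proof.
move=> gL gA; rewrite !normrM (ger0_norm (density_ge0 hf x)).
rewrite ler_wpM2r ?(density_ge0 hf)// add0r mulrC.
rewrite -[x ^+ 2]real_normK ?num_real// expr2 mulrA -mulrDl ler_wpM2r//.
by rewrite (le_trans (lip_le_growth x gL))// lerD2r.
Qed.

Lemma integrable_K_density L g : lip_le L g ->
  lebesgue.-integrable setT (EFin \o (fun x => K M g x * f x)).
Proof.
move=> gL; apply: (integrable_dominated (measurable_K_density gL)
  (integrable_quadratic_density hf hM0 _ _ _)) => x.
exact: norm_K_density_le.
Qed.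

Lemma integrable_id_density L g : lip_le L g ->
  lebesgue.-integrable setT (EFin \o (fun x => x * g x * f x)).
Proof.
move=> gL; apply: (integrable_dominated (measurable_id_density gL)
  (integrable_quadratic_density hf hM0 _ _ _)) => x.
exact: norm_id_density_le.
Qed.

(** The mode of convergence under which both sides are continuous: [K] is
    bounded by the Lipschitz constant, while [x * g x] grows quadratically and is
    dominated thanks to the second moment of [f]. *)
Lemma stein_limit L A (g_ : nat -> R -> R) g :
  (forall n, lip_le L (g_ n)) -> (forall n, `|g_ n 0| <= A) -> lip_le L g ->
  (forall x, g_ n x @[n --> \oo] --> g x) ->
  (forall n, stein_identity f M (g_ n)) -> stein_identity f M g.
Proof.
move=> gL_ gA gL gg gs.
have cK : \int[lebesgue]_x (K M (g_ n) x * f x) @[n --> \oo] -->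
    \int[lebesgue]_x (K M g x * f x).
  apply: (Rintegral_dominated_cvg _ _ _ (integrable_quadratic_density hf hM0 _ _ _)).
  - by move=> n; exact: measurable_K_density (gL_ n).
  - exact: measurable_K_density gL.
  - move=> x; apply: cvgM; last exact: cvg_cst.
    exact: K_cvg gL_ gL gg.
  - by move=> n x; exact: norm_K_density_le.
have cid : \int[lebesgue]_x (x * g_ n x * f x) @[n --> \oo] -->
    \int[lebesgue]_x (x * g x * f x).
  apply: (Rintegral_dominated_cvg _ _ _ (integrable_quadratic_density hf hM0 _ _ _)).
  - by move=> n; exact: measurable_id_density (gL_ n).
  - exact: measurable_id_density gL.
  - move=> x; apply: cvgM; last exact: cvg_cst.
    by apply: cvgM => //; exact: cvg_cst.
  - by move=> n x; exact: norm_id_density_le.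
have sE : (fun n => \int[lebesgue]_x (K M (g_ n) x * f x)) =
    (fun n => \int[lebesgue]_x (x * g_ n x * f x)).
  by apply/funext => n; exact: gs.
by rewrite sE in cK; exact: cvg_unique cK cid.
Qed.

(** The Lipschitz bound provides the integrability that makes the identity stable
    under linear combinations. *)
Definition stein_class g := (exists L, lip_le L g) /\ stein_identity f M g.

Lemma stein_class_add g h :
  stein_class g -> stein_class h -> stein_class (fun x => g x + h x).
Proof.
move=> [[L1 gL] gs] [[L2 hL] hs]; split; first by exists (L1 + L2); exact: lip_leD.
rewrite /stein_identity; transitivity
  (\int[lebesgue]_x (K M g x * f x + K M h x * f x)).
  by apply: eq_Rintegral => x _; rewrite (K_add M x gL hL) mulrDl.
rewrite (RintegralD measurableT (integrable_K_density gL) (integrable_K_density hL)).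
rewrite gs hs.
rewrite -(RintegralD measurableT (integrable_id_density gL) (integrable_id_density hL)).
by apply: eq_Rintegral => x _; rewrite mulrDr mulrDl.
Qed.

Lemma stein_class_scale c g : stein_class g -> stein_class (fun x => c * g x).
Proof.
move=> [[L gL] gs]; split; first by exists (`|c| * L); exact: lip_leZ.
rewrite /stein_identity; transitivity (\int[lebesgue]_x (c * (K M g x * f x))).
  by apply: eq_Rintegral => x _; rewrite (K_scale M c x gL) mulrA.
rewrite (RintegralZl _ measurableT (integrable_K_density gL)) gs.
rewrite -(RintegralZl _ measurableT (integrable_id_density gL)).
by apply: eq_Rintegral => x _; ring.
Qed.

Lemma stein_class_cos t : stein_class (fun x => cos (t * x)).
Proof. by split; [exists `|t|; exact: lip_le_cos|exact: stein_cos]. Qed.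

Lemma stein_class_sin t : stein_class (fun x => sin (t * x)).
Proof. by split; [exists `|t|; exact: lip_le_sin|exact: stein_sin]. Qed.

End stein_class.

(** * Bernstein polynomials by de Casteljau's recursion *)

Section de_casteljau.
Context (R : realType).
Implicit Types (c e : nat -> R) (s : R).

(** Value at [s] of the Bernstein polynomial with control values [c 0, ..., c n],
    defined by de Casteljau's recursion: it is the mean of [c] under the binomial
    law, and every property needed below follows by induction on [n] without
    binomial coefficients. *)
Fixpoint bernstein n c s : R :=
  if n is m.+1
  then (1 - s) * bernstein m c s + s * bernstein m (c \o succn) s else c 0%N.

Lemma bernstein_affine n a b c s :
  bernstein n (fun k => a + b * c k) s = a + b * bernstein n c s.
Proof.
by elim: n c => [//|n IH] c /=; rewrite IH (IH (c \o succn)); ring.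
Qed.

(** The weights of [bernstein] are nonnegative. *)
Lemma norm_bernsteinB_le n c c' e s : 0 <= s <= 1 ->
  (forall k, `|c k - c' k| <= e k) ->
  `|bernstein n c s - bernstein n c' s| <= bernstein n e s.
Proof.
move=> /andP[s0 s1]; elim: n c c' e => [|n IH] c c' e ce /=; first exact: ce.
have -> : (1 - s) * bernstein n c s + s * bernstein n (c \o succn) s -
    ((1 - s) * bernstein n c' s + s * bernstein n (c' \o succn) s) =
    (1 - s) * (bernstein n c s - bernstein n c' s) +
    s * (bernstein n (c \o succn) s - bernstein n (c' \o succn) s) by ring.
rewrite (le_trans (ler_normD _ _))// !normrM (ger0_norm s0) ger0_norm ?subr_ge0//.
by apply: lerD; apply: ler_wpM2l; rewrite ?subr_ge0//; apply: IH => k /=.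
Qed.

Lemma bernstein_cst n y s : bernstein n (fun=> y) s = y.
Proof. by elim: n => [//|n IH] /=; rewrite IH; ring. Qed.

(** The second moment of the binomial law about [- a]; the shift makes the
    induction go through. *)
Lemma bernstein_sqr n a s :
  bernstein n (fun k => (k%:R + a) ^+ 2) s =
  (n%:R * s + a) ^+ 2 + n%:R * s * (1 - s).
Proof.
elim: n a => [|n IH] a /=; first by rewrite !mul0r !add0r addr0.
have -> : (fun k : nat => (k%:R + a) ^+ 2) \o succn =
    (fun k => (k%:R + (a + 1)) ^+ 2).
  by apply/funext => k /=; rewrite -natr1; ring.
by rewrite !IH -natr1; ring.
Qed.

(** Unlike a general uniform polynomial approximation, Bernstein polynomials do
    not increase Lipschitz constants. *)
Lemma bernstein_lip n c d s s' : 0 <= s <= 1 -> 0 <= s' <= 1 ->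
  (forall k, `|c k.+1 - c k| <= d) ->
  `|bernstein n c s - bernstein n c s'| <= n%:R * d * `|s - s'|.
Proof.
move=> s01 s01'; elim: n c => [|n IH] c cd /=; first by rewrite subrr normr0 !mul0r.
have -> : (1 - s) * bernstein n c s + s * bernstein n (c \o succn) s -
    ((1 - s') * bernstein n c s' + s' * bernstein n (c \o succn) s') =
    (1 - s) * (bernstein n c s - bernstein n c s') +
    s * (bernstein n (c \o succn) s - bernstein n (c \o succn) s') +
    (bernstein n (c \o succn) s' - bernstein n c s') * (s - s') by ring.
have cd' k : `|(c \o succn) k.+1 - (c \o succn) k| <= d by exact: cd.
have := norm_bernsteinB_le n s01' cd; rewrite bernstein_cst => step.
move: (IH _ cd) (IH _ cd') => I1 I2; have /andP[s0 s1] := s01.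
have s1' : 0 <= 1 - s by rewrite subr_ge0.
rewrite (le_trans (ler_normD _ _))// (le_trans (lerD (ler_normD _ _) (lexx _)))//.
rewrite !normrM (ger0_norm s0) (ger0_norm s1') -natr1.
have := ler_wpM2r (normr_ge0 (s - s')) step.
have := ler_wpM2l s0 I2; have := ler_wpM2l s1' I1.
set X := `|s - s'|; lra.
Qed.

(** Bernstein's rate for a Lipschitz function transported from [-N, N] to [0, 1].
    The degree is taken to be a square, so that the standard deviation of the
    binomial law is of order [m] and no square root appears. *)
Lemma bernstein_approx m (g : R -> R) L N s : (0 < m)%N -> 0 <= s <= 1 -> 0 < N ->
  lip_le L g ->
  `|bernstein (m ^ 2) (fun k => g (N * (2 * (k%:R / (m ^ 2)%:R) - 1))) s -
    g (N * (2 * s - 1))| <= 2 * L * N / m%:R.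
Proof.
move=> m0 s01 N0 gL; set y := g (N * _).
have L0 := lip_le_ge0 gL.
have m0R : 0 < m%:R :> R by rewrite ltr0n.
have m_neq0 : m%:R != 0 :> R by rewrite gt_eqF.
(* With u = k - m^2 s, the linear bound on the increment of g is turned into a
   quadratic one by 2 |u| <= m + u^2 / m, since second moments are explicit. *)
pose e (k : nat) := N * L / m%:R + N * L / m%:R ^+ 3 * (k%:R + - (m%:R ^+ 2 * s)) ^+ 2.
have ce k : `|g (N * (2 * (k%:R / (m ^ 2)%:R) - 1)) - y| <= e k.
  apply: (le_trans (gL _ _)); rewrite natrX.
  set u : R := k%:R + - (m%:R ^+ 2 * s).
  have -> : N * (2 * (k%:R / m%:R ^+ 2) - 1) - N * (2 * s - 1) =
      2 * N / m%:R ^+ 2 * u by rewrite /u; field.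
  rewrite normrM ger0_norm ?divr_ge0 ?mulr_ge0 ?exprn_ge0 ?(ltW N0)//.
  have -> : e k = L * (2 * N / m%:R ^+ 2 * ((m%:R + u ^+ 2 / m%:R) / 2)).
    by rewrite /e -/u; field.
  rewrite !ler_wpM2l ?divr_ge0 ?mulr_ge0 ?exprn_ge0 ?(ltW N0)//.
  rewrite -[u ^+ 2]real_normK ?num_real// ler_pdivlMr// -subr_ge0.
  have -> : m%:R + `|u| ^+ 2 / m%:R - `|u| * 2 = (m%:R - `|u|) ^+ 2 / m%:R by field.
  by rewrite divr_ge0 ?sqr_ge0 ?ltW.
have := norm_bernsteinB_le (m ^ 2) s01 ce; rewrite bernstein_cst => /le_trans; apply.
rewrite bernstein_affine bernstein_sqr natrX subrr expr0n add0r.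
have -> : N * L / m%:R + N * L / m%:R ^+ 3 * (m%:R ^+ 2 * s * (1 - s)) =
   N * L / m%:R * (1 + s * (1 - s)) by field.
have -> : 2 * L * N / m%:R = N * L / m%:R * 2 by ring.
rewrite ler_wpM2l ?divr_ge0 ?mulr_ge0 ?(ltW N0) ?(ltW m0R)//.
by have /andP[s0 s1] := s01; nra.
Qed.

End de_casteljau.

(** * Lipschitz approximation by trigonometric polynomials *)

Section trigonometric_approximation.
Context (R : realType).

(** The affine map [s |-> N (2 s - 1)] takes [0, 1] to [-N, N] and
    [unit_sine (1 / N) x] to [N sin (x / N)]. *)
Definition unit_sine (a x : R) : R := (1 + sin (a * x)) / 2.

Lemma unit_sine_itv a x : 0 <= unit_sine a x <= 1.
Proof. by rewrite /unit_sine; have := sin_geN1 (a * x); have := sin_le1 (a * x); lra. Qed.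

(** With [N = n.+1], this is the Bernstein polynomial of degree [N^4] of [g] on
    [-N, N], composed with [x |-> N sin (x / N)]: a trigonometric polynomial. The
    degree makes the polynomial approximation error [O(1/N)] despite the growing
    interval. *)
Definition trig_approx (g : R -> R) (n : nat) (x : R) : R :=
  bernstein ((n.+1 ^ 2) ^ 2)
    (fun k => g (n.+1%:R * (2 * (k%:R / ((n.+1 ^ 2) ^ 2)%:R) - 1)))
    (unit_sine n.+1%:R^-1 x).

Lemma lip_le_trig_approx L g n : lip_le L g -> lip_le L (trig_approx g n).
Proof.
move=> gL x y; have n0 : n.+1%:R != 0 :> R by rewrite pnatr_eq0.
have N0 : 0 < n.+1%:R :> R by [].
have M0 : 0 < ((n.+1 ^ 2) ^ 2)%:R :> R by rewrite ltr0n !expn_gt0.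
have step k : `|g (n.+1%:R * (2 * (k.+1%:R / ((n.+1 ^ 2) ^ 2)%:R) - 1)) -
    g (n.+1%:R * (2 * (k%:R / ((n.+1 ^ 2) ^ 2)%:R) - 1))| <=
    L * (2 * n.+1%:R / ((n.+1 ^ 2) ^ 2)%:R).
  apply: (le_trans (gL _ _)); rewrite ler_wpM2l ?(lip_le_ge0 gL)// -[k.+1%:R]natr1.
  set m : R := ((n.+1 ^ 2) ^ 2)%:R; set N : R := n.+1%:R.
  have -> : N * (2 * ((k%:R + 1) / m) - 1) - N * (2 * (k%:R / m) - 1) = 2 * N / m.
    by field; rewrite gt_eqF.
  by rewrite ger0_norm// divr_ge0 ?mulr_ge0// ltW.
apply: (le_trans (bernstein_lip _ (unit_sine_itv _ _) (unit_sine_itv _ _) step)).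
have sxy := lip_le_sin n.+1%:R^-1 x y.
have -> : unit_sine n.+1%:R^-1 x - unit_sine n.+1%:R^-1 y =
    (sin (n.+1%:R^-1 * x) - sin (n.+1%:R^-1 * y)) / 2.
  by rewrite /unit_sine; field.
rewrite normrM (@ger0_norm _ 2^-1)//.
have -> : ((n.+1 ^ 2) ^ 2)%:R * (L * (2 * n.+1%:R / ((n.+1 ^ 2) ^ 2)%:R)) =
    L * (2 * n.+1%:R) :> R.
  by move: M0; set m : R := ((n.+1 ^ 2) ^ 2)%:R => M0; field; rewrite gt_eqF.
rewrite -mulrA ler_wpM2l ?(lip_le_ge0 gL)//.
rewrite [`|_^-1|]ger0_norm ?invr_ge0// in sxy.
have -> : `|x - y| = 2 * n.+1%:R * (n.+1%:R^-1 * `|x - y| / 2) by field.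
by apply: ler_wpM2l; [rewrite mulr_ge0|apply: ler_wpM2r].
Qed.

(** Sum of the error of the Bernstein polynomial and of the error made in
    replacing [x] by [N sin (x / N)]. *)
Lemma trig_approx_error L g n x : lip_le L g ->
  `|trig_approx g n x - g x| <= (2 * L + L * x ^+ 2) / n.+1%:R.
Proof.
move=> gL; have N0 : 0 < n.+1%:R :> R by [].
have := bernstein_approx (m := n.+1 ^ 2) (N := n.+1%:R) _ (unit_sine_itv n.+1%:R^-1 x) N0 gL.
rewrite expn_gt0 => /(_ isT); rewrite -/(trig_approx g n x).
have -> : 2 * unit_sine n.+1%:R^-1 x - 1 = sin (x / n.+1%:R).
  by rewrite /unit_sine [_^-1 * x]mulrC; field.
rewrite natrX.
have -> : 2 * L * n.+1%:R / n.+1%:R ^+ 2 = 2 * L / n.+1%:R :> R.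
  by field; rewrite gt_eqF.
move=> h1.
have h2 := gL (n.+1%:R * sin (x / n.+1%:R)) x.
have h3 := ler_wpM2l (lip_le_ge0 gL) (norm_scaled_sin_sub_le n x).
rewrite mulrDl -[L * _ / _]mulrA.
apply: le_trans (lerD h1 (le_trans h2 h3)).
by apply: le_trans (ler_normD _ _); rewrite addrA subrK.
Qed.

Context (f : R -> R) (M : {finite_measure set (measurableTypeR R) -> \bar R}).
Context (hf : infdiv_density2 f 0 M) (hM0 : M [set 0] = 0%E).

(** Expanding one step of de Casteljau's recursion multiplies by a sine, which
    only shifts the frequency [t]; carrying an arbitrary factor [cos (t * x)] or
    [sin (t * x)] makes this an induction on [n]. *)
Lemma stein_class_bernstein_trig n a c t :
  stein_class f M (fun x => bernstein n c (unit_sine a x) * cos (t * x)) /\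
  stein_class f M (fun x => bernstein n c (unit_sine a x) * sin (t * x)).
Proof.
elim: n c t => [|n IH] c t.
  split => /=; apply: (stein_class_scale hf hM0).
    exact: stein_class_cos.
  exact: stein_class_sin.
have scD := stein_class_add hf hM0; have scZ := stein_class_scale hf hM0.
split => /=.
- rewrite (_ : (fun x => _) = fun x =>
     2^-1 * (bernstein n c (unit_sine a x) * cos (t * x)) +
    (2^-1 * (bernstein n (c \o succn) (unit_sine a x) * cos (t * x)) +
    (- 4^-1 * (bernstein n c (unit_sine a x) * sin ((t + a) * x)) +
    (4^-1 * (bernstein n c (unit_sine a x) * sin ((t - a) * x)) +
    (4^-1 * (bernstein n (c \o succn) (unit_sine a x) * sin ((t + a) * x)) +
    - 4^-1 * (bernstein n (c \o succn) (unit_sine a x) * sin ((t - a) * x))))))).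
    by do 5 (apply: (@scD); first by apply: (@scZ); first [exact: (IH _ _).1|exact: (IH _ _).2]);
      apply: (@scZ); exact: (IH _ _).2.
  apply/funext => x; set B := bernstein n c _; set B' := bernstein n (c \o _) _.
  by rewrite /unit_sine (mulrDl t a x) (mulrBl x t a) sinD sinB; field.
- rewrite (_ : (fun x => _) = fun x =>
     2^-1 * (bernstein n c (unit_sine a x) * sin (t * x)) +
    (2^-1 * (bernstein n (c \o succn) (unit_sine a x) * sin (t * x)) +
    (4^-1 * (bernstein n c (unit_sine a x) * cos ((t + a) * x)) +
    (- 4^-1 * (bernstein n c (unit_sine a x) * cos ((t - a) * x)) +
    (- 4^-1 * (bernstein n (c \o succn) (unit_sine a x) * cos ((t + a) * x)) +
    4^-1 * (bernstein n (c \o succn) (unit_sine a x) * cos ((t - a) * x))))))).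
    by do 5 (apply: (@scD); first by apply: (@scZ); first [exact: (IH _ _).1|exact: (IH _ _).2]);
      apply: (@scZ); exact: (IH _ _).1.
  apply/funext => x; set B := bernstein n c _; set B' := bernstein n (c \o _) _.
  by rewrite /unit_sine (mulrDl t a x) (mulrBl x t a) cosD cosB; field.
Qed.

Lemma stein_identity_trig_approx g n : stein_identity f M (trig_approx g n).
Proof.
have [[_ h] _] := stein_class_bernstein_trig ((n.+1 ^ 2) ^ 2) n.+1%:R^-1
  (fun k => g (n.+1%:R * (2 * (k%:R / ((n.+1 ^ 2) ^ 2)%:R) - 1))) 0.
congr (stein_identity f M _) : h; apply/funext => x.
by rewrite mul0r cos0 mulr1.
Qed.

Lemma stein_identity_lipschitz L g : lip_le L g -> stein_identity f M g.
Proof.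
move=> gL; apply: (stein_limit hf hM0 (L := L) (A := `|g 0| + 2 * L)
  (g_ := trig_approx g)) => //.
- by move=> n; exact: lip_le_trig_approx.
- move=> n; have := trig_approx_error n 0 gL; rewrite expr0n /= mulr0 addr0 => h.
  have {}h : `|trig_approx g n 0 - g 0| <= 2 * L.
    rewrite (le_trans h)// ler_piMr ?mulr_ge0 ?(lip_le_ge0 gL)//.
    by rewrite invf_le1// ler1n.
  by rewrite -(subrK (g 0) (trig_approx g n 0)) addrC (le_trans (ler_normD _ _))// lerD2l.
- by move=> x; apply: cvg_harmonic_bound => n; exact: trig_approx_error.
- exact: stein_identity_trig_approx.
Qed.

End trigonometric_approximation.

Theorem theorem2 (R : realType) (f : R -> R) (b : R)
    (M : {finite_measure set (measurableTypeR R) -> \bar R}) (g : R -> R)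
    (hf : infdiv_density2 f b M)
    (hM0 : M [set 0] = 0%E)
    (hb : b = 0)
    (hg : lipschitz g) :
  [/\ forall t : R, M.-integrable setT (fun x => (diff_quot g t x)%:E),
      bounded_fun (K M g),
      continuous (K M g)
    & forall theta : R,
      [/\ (@lebesgue_measure R).-integrable setT
            (fun x => (K M g (x + theta) * f x)%:E),
          (@lebesgue_measure R).-integrable setT
            (fun x => (x * g (x + theta) * f x)%:E)
        & \int[@lebesgue_measure R]_x (K M g (x + theta) * f x)
          = \int[@lebesgue_measure R]_x (x * g (x + theta) * f x)] ].
Proof.
subst b; have [L gL] := lipschitz_lip_le hg.
split.
- by move=> t; exact: integrable_diff_quot gL.
- exists (L * fine (M setT)); split; first exact: num_real.
  by move=> c /ltW Lc t _ /=; apply: le_trans (norm_K_le M t gL) Lc.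
- exact: K_continuous gL.
move=> theta; have gL' := lip_le_shift theta gL.
have KE x : K M g (x + theta) = K M (fun y => g (y + theta)) x.
  by rewrite K_shift.
split.
- apply: eq_integrable (integrable_K_density hf hM0 gL') => // x _.
  by rewrite /= KE.
- exact: (integrable_id_density hf hM0 gL').
- under eq_Rintegral do rewrite KE.
  exact: (stein_identity_lipschitz hf hM0 gL').
Qed.
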